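(* Let $R$ be an associative ring with unit and let $I$ be an idempotent two-sided ideal of $R$. If the left $R$-module $R/I$ admits a projective cover and $R/I$ is a silting module, then $I$ is the trace of a projective left $R$-module.
   Context: Idempotent means $I^2=I$. The trace of a left $R$-module $P$ is $\mathrm{Tr}(P)=\sum_{f\in \mathrm{Hom}_R(P,R)}\mathrm{Im}(f)$, a two-sided ideal of $R$. Projective modules are not assumed finitely generated. A projective cover of a module $M$ is an epimorphism $\pi:P\to M$ with $P$ projective such that every $f:P\to P$ with $\pi\circ f=\pi$ is an isomorphism. For a morphism $\sigma$ of left $R$-modules put $\mathcal{D}_\sigma=\{X\in R\text{-}\mathrm{Mod} : \mathrm{Hom}_R(\sigma,X)\text{ is surjective}\}$. For a module $S$, $\mathrm{Gen}(S)$ is the class of modules $M$ admitting an epimorphism $S^{(\alpha)}\to M$ for some set $\alpha$. A module $S$ is silting if there is a morphism $\sigma:P_{-1}\to P_0$ between projective modules with $S\cong\mathrm{Coker}(\sigma)$ and $\mathcal{D}_\sigma=\mathrm{Gen}(S)$. *)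

(* Defs.v *)
From HB Require Import structures.
From mathcomp Require Import all_boot all_algebra.
From mathcomp Require Import boolp classical_sets functions cardinality.

Set Implicit Arguments.
Unset Strict Implicit.
Unset Printing Implicit Defensive.

Import GRing.Theory.
Local Open Scope classical_set_scope.
Local Open Scope ring_scope.
Local Open Scope quotient_scope.

(* Left [R]-modules are [lmodType R], with [R : pzRingType] an arbitrary
    associative unital ring (possibly zero, not necessarily commutative);
    [R^o] is [R] as a left module over itself.  Epimorphisms of modules are
    surjective linear maps. *)

Definition surjective (A B : Type) (f : A -> B) := forall y, exists x, f x = y.

Definition isomorphic (R : pzRingType) (M N : lmodType R) :=
  exists f : {linear M -> N}, bijective f.

Section QuotientModule.
Variables (R : pzRingType) (M : lmodType R) (N : submodClosed M).

(* [submodClosed] is stated for semimodules, so the closure under opposites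
   required by [Quotient.quot] is derived here, on an alias of N. *)
Definition submod_zmod : {pred M} := N.
HB.instance Definition _ :=
  GRing.isZmodClosed.Build M submod_zmod (GRing.submod_closedB (GRing.submodClosedP N)).

Definition quotmod := Quotient.quot submod_zmod.
HB.instance Definition _ := GRing.Zmodule.on quotmod.

Definition quotmod_scale (a : R) : quotmod -> quotmod :=
  lift_op1 quotmod (fun x : M => a *: x).

Lemma pi_quotmod_scale a (x : M) :
  quotmod_scale a (\pi_quotmod x) = \pi_quotmod (a *: x).
Proof.
rewrite /quotmod_scale; unlock; apply/eqP; rewrite piE Quotient.equivE.
rewrite -scalerBr /submod_zmod /=; apply: (@rpredZ _ _ N).
by have := Quotient.idealrBE submod_zmod (repr (\pi_quotmod x)) x; rewrite reprK eqxx.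
Qed.

Fact quotmod_scaleA a b v :
  quotmod_scale a (quotmod_scale b v) = quotmod_scale (a * b) v.
Proof. by rewrite -[v]reprK !pi_quotmod_scale scalerA. Qed.

Fact quotmod_scale1 : left_id 1 quotmod_scale.
Proof. by move=> v; rewrite -[v]reprK pi_quotmod_scale scale1r. Qed.

Fact quotmod_scaleDr : right_distributive quotmod_scale +%R.
Proof.
move=> a u v; rewrite -[u]reprK -[v]reprK !pi_quotmod_scale.
by rewrite -!raddfD /= pi_quotmod_scale scalerDr.
Qed.

Fact quotmod_scaleDl v : {morph quotmod_scale^~ v : a b / a + b}.
Proof.
by move=> a b; rewrite -[v]reprK !pi_quotmod_scale -!raddfD /= scalerDl.
Qed.

HB.instance Definition _ := GRing.Zmodule_isLmodule.Build R quotmod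
  quotmod_scaleA quotmod_scale1 quotmod_scaleDr quotmod_scaleDl.

Definition quotpi : M -> quotmod := \pi_quotmod.

Fact quotpi_is_linear : linear quotpi.
Proof. by move=> a x y; rewrite /quotpi raddfD /= -pi_quotmod_scale. Qed.
HB.instance Definition _ := GRing.isLinear.Build R M quotmod _ quotpi
  quotpi_is_linear.

Lemma quotpi_surjective : surjective quotpi.
Proof. by move=> y; exists (repr y); exact: reprK. Qed.

Lemma quotpi_eq0 x : (quotpi x == 0) = (x \in N).
Proof.
rewrite -(raddf0 quotpi) /quotpi -(Quotient.idealrBE submod_zmod x 0).
by rewrite subr0.
Qed.

End QuotientModule.

Section Cokernel.
Variables (R : pzRingType) (M N : lmodType R) (f : {linear M -> N}).

Definition im : {pred N} := fun y => `[< exists x, f x = y >].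

Fact im_submod_closed : submod_closed im.
Proof.
split=> [|a u v]; first by apply/asboolP; exists 0; rewrite raddf0.
move=> /asboolP[x <-] /asboolP[y <-]; apply/asboolP.
by exists (a *: x + y); rewrite linearP.
Qed.

HB.instance Definition _ := GRing.isSubmodClosed.Build R N im im_submod_closed.

Definition coker : lmodType R := quotmod im.

End Cokernel.

Section DirectSum.
Variables (alpha : Type) (R : pzRingType) (S : lmodType R).

Definition finite_support : {pred alpha -> S} :=
  fun f => `[< finite_set [set i | f i <> 0] >].

Fact finite_support_submod_closed : submod_closed finite_support.
Proof.
split=> [|a u v].
  apply/asboolP; rewrite (_ : [set _ | _] = set0) //.
  by apply/seteqP; split=> // i /=.
move=> /asboolP fu /asboolP fv; apply/asboolP.
apply: (@sub_finite_set _ _ ([set i | u i <> 0] `|` [set i | v i <> 0])).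
  move=> i /= /eqP uvi; have [ui|/eqP ui] := eqVneq (u i) 0; last by left.
  right=> vi; move/eqP: uvi; apply; rewrite fctE.
  by rewrite vi addr0 /GRing.scale /= ui scaler0.
by rewrite finite_setU.
Qed.

HB.instance Definition _ :=
  GRing.isSubmodClosed.Build R (alpha -> S) finite_support
    finite_support_submod_closed.

(* S^(alpha) *)
Definition dsum := {f : alpha -> S | f \in finite_support}.
HB.instance Definition _ := [isSub of dsum for @sval _ _].
HB.instance Definition _ := [Choice of dsum by <:].
HB.instance Definition _ := [SubChoice_isSubLmodule of dsum by <:].

End DirectSum.

HB.mixin Record isRMulClosed (R : pzRingType) (I : {pred R^o}) := {
  rmul_closed : forall x a, x \in I -> x * a \in I
}.

#[short(type="twoSidedIdeal")]
HB.structure Definition TwoSidedIdeal (R : pzRingType) :=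
  {I of isRMulClosed R I & GRing.SubmodClosed R^o I}.

Definition finite_sums (V : zmodType) (A : set V) : set V :=
  [set x | exists s : seq V, (forall y, y \in s -> A y) /\ x = \sum_(y <- s) y].

Definition ideal_mul (R : pzRingType) (I J : {pred R}) : set R :=
  finite_sums [set z | exists x y, [/\ x \in I, y \in J & z = x * y]].

(* The sum of the submodules Im f is the set of finite sums of elements of
   their union. *)
Definition trace (R : pzRingType) (P : lmodType R) : set R :=
  finite_sums (\bigcup_(f in [set: {linear P -> R^o}]) range f).

Section Modules.
Variable R : pzRingType.

Definition projective (P : lmodType R) :=
  forall (M N : lmodType R) (g : {linear M -> N}) (f : {linear P -> N}),
    surjective g -> exists h : {linear P -> M}, g \o h =1 f.

Definition projective_cover (P M : lmodType R) (p : {linear P -> M}) :=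
  [/\ projective P, surjective p &
      forall f : {linear P -> P}, p \o f =1 p -> bijective f].

(* X belongs to D_sigma *)
Definition Dclass (P1 P0 : lmodType R) (sigma : {linear P1 -> P0})
    (X : lmodType R) :=
  forall g : {linear P1 -> X}, exists h : {linear P0 -> X}, h \o sigma =1 g.

Definition Gen (S M : lmodType R) :=
  exists (alpha : Type) (f : {linear dsum alpha S -> M}), surjective f.

Definition silting (S : lmodType R) :=
  exists (P1 P0 : lmodType R) (sigma : {linear P1 -> P0}),
    [/\ projective P1, projective P0, isomorphic S (coker sigma) &
        forall X : lmodType R, Dclass sigma X <-> Gen S X].

End Modules.

(* Main.v *)
Require Import Defs.
From HB Require Import structures.
From mathcomp Require Import all_boot all_algebra.
From mathcomp Require Import boolp classical_sets functions cardinality.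

Set Implicit Arguments.
Unset Strict Implicit.
Unset Printing Implicit Defensive.

Import GRing.Theory.
Local Open Scope classical_set_scope.
Local Open Scope ring_scope.

(** Write [S = R/I], let [p : P -> S] be a projective cover, and let
    [sigma : P1 -> P0] be a presentation of [S] with [Dclass sigma = Gen S].

    Every epimorphism from a projective module [A] onto [S] contains [p] as a
    direct summand ([projective_cover_split]).  For [A = R] this gives an
    idempotent [e] such that [P] is isomorphic to [R e] and [1 - e] lies in
    [I].  For [A = P0] it gives [P0 = P + P'] where [P'] lies in the image of
    [sigma]; lifting the projection onto [P'] along [sigma] splits a copy of
    [P'] off [P1], leaving a projective module [P1'] (the image of an idempotent
    [q] of [P1]) which [sigma] maps onto the copy of [ker p] in [P0]
    ([presentation_reduction]).  Now [ker p = I P] is a copy of [I e], and the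
    required projective module is [P1' + R (1 - e)].

    Its trace contains [I], because [i = i e + i (1 - e)] for [i] in [I], where
    [i e] comes from [P1'] through [sigma], and [i (1 - e)] comes from
    [R (1 - e)].

    Its trace lies in [I].  For [R (1 - e)] this holds because [1 - e] is in [I].
    A map [f : P1' -> R] induces a map [P1' -> R/I].  Since [R/I] lies in
    [Gen S], hence in [Dclass sigma], this map factors through the restriction of
    [sigma] to [P1'], whose image is [I P].  But every map to [R/I] kills [I P]
    ([cover_kernel_vanish]), so [f] takes its values in [I]. *)

(** * Submodules and linear maps *)

Section Submodule.
Variables (R : pzRingType) (M : lmodType R) (N : submodClosed M).

Definition submodule := {x : M | x \in N}.
HB.instance Definition _ := [isSub of submodule for @sval _ _].
HB.instance Definition _ := [Choice of submodule by <:].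
HB.instance Definition _ := [SubChoice_isSubLmodule of submodule by <:].

Lemma corestriction (L : lmodType R) (f : {linear L -> M}) :
    (forall x, f x \in N) ->
  exists g : {linear L -> submodule}, forall x, val (g x) = f x.
Proof.
move=> fN; pose g x : submodule := exist _ (f x) (fN x).
have g_lin : linear g.
  by move=> a x y; apply: val_inj; rewrite [LHS]linearP [RHS]linearP.
pose G : {linear L -> submodule} :=
  HB.pack g (GRing.isLinear.Build R L submodule _ g g_lin).
by exists G.
Qed.

End Submodule.

Lemma linear_inverse (R : pzRingType) (M N : lmodType R) (f : {linear M -> N}) :
  bijective f -> exists g : {linear N -> M}, cancel f g /\ cancel g f.
Proof.
move=> [g fK gK].
have g_lin : linear g by exact: can2_linear fK gK.
pose G : {linear N -> M} := HB.pack g (GRing.isLinear.Build R N M _ g g_lin).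
by exists G.
Qed.

Lemma sub_idem (R : pzRingType) (M : lmodType R) (f : {linear M -> M}) :
  (forall x, f (f x) = f x) ->
  exists g : {linear M -> M},
    (forall x, g x = x - f x) /\ (forall x, g (g x) = g x).
Proof.
move=> ff; exists (idfun \- f); split=> [//|x] /=.
by rewrite linearB /= ff subrr subr0.
Qed.

Section ProductInjections.
Variables (R : pzRingType) (P Q : lmodType R).

Definition prod_inl (x : P) : P * Q := (x, 0).
Definition prod_inr (y : Q) : P * Q := (0, y).

Fact prod_inl_is_linear : linear prod_inl.
Proof. by move=> a x y; congr pair; rewrite /= scaler0 addr0. Qed.
HB.instance Definition _ :=
  GRing.isLinear.Build R P (P * Q)%type _ prod_inl prod_inl_is_linear.

Fact prod_inr_is_linear : linear prod_inr.
Proof. by move=> a x y; congr pair; rewrite /= scaler0 addr0. Qed.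
HB.instance Definition _ :=
  GRing.isLinear.Build R Q (P * Q)%type _ prod_inr prod_inr_is_linear.

Lemma pair_split (x : P) (y : Q) : (x, y) = prod_inl x + prod_inr y.
Proof. by congr pair; rewrite /= ?addr0 ?add0r. Qed.

End ProductInjections.

(** * Projective modules *)

Lemma projective_regular (R : pzRingType) : projective (R^o : lmodType R).
Proof.
move=> M N g f /(_ (f 1))[m gm].
pose h (r : R^o) : M := (r : R) *: m.
have h_lin : linear h by move=> a x y; rewrite /h scalerDl scalerA.
pose H : {linear R^o -> M} := HB.pack h (GRing.isLinear.Build R R^o M _ h h_lin).
exists H => r /=; rewrite /h linearZ /= gm -linearZ /=.
by congr (f _); exact: mulr1.
Qed.

Lemma projective_prod (R : pzRingType) (P Q : lmodType R) :
  projective P -> projective Q -> projective (P * Q)%type.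
Proof.
move=> projP projQ M N g f g_surj.
have [h hE] := projP _ _ g (f \o @prod_inl _ P Q) g_surj.
have [k kE] := projQ _ _ g (f \o @prod_inr _ P Q) g_surj.
exists ((h \o fst) \+ (k \o snd)) => -[x y] /=.
rewrite linearD /=; have /= -> := hE x; have /= -> := kE y.
by rewrite -linearD /= -pair_split.
Qed.

Lemma projective_lift_im (R : pzRingType) (P M N : lmodType R)
    (g : {linear M -> N}) (f : {linear P -> N}) :
    projective P -> (forall x, exists y, g y = f x) ->
  exists h : {linear P -> M}, forall x, g (h x) = f x.
Proof.
move=> projP f_im.
have [g' g'E] : exists g' : {linear M -> submodule (im g)},
    forall x, val (g' x) = g x.
  by apply: corestriction => x; apply/asboolP; exists x.
have [f' f'E] : exists f' : {linear P -> submodule (im g)},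
    forall x, val (f' x) = f x.
  by apply: corestriction => x; apply/asboolP; exact: f_im.
have g'_surj : surjective g'.
  by move=> [y y_im]; have /asboolP[x gx] := y_im; exists x; apply: val_inj; rewrite g'E.
have [h hE] := projP _ _ g' f' g'_surj.
by exists h => x; rewrite -g'E -f'E; have /= -> := hE x.
Qed.

Lemma idempotent_split (R : pzRingType) (P : lmodType R)
    (q : {linear P -> P}) :
    projective P -> (forall x, q (q x) = q x) ->
  exists (Q : lmodType R) (j : {linear Q -> P}) (r : {linear P -> Q}),
    [/\ projective Q, cancel j r & forall x, j (r x) = q x].
Proof.
move=> projP qq.
have [r rE] : exists r : {linear P -> submodule (im q)},
    forall x, val (r x) = q x.
  by apply: corestriction => x; apply/asboolP; exists x.
have jK : cancel (val : submodule (im q) -> P) r.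
  move=> [y y_im]; apply: val_inj; rewrite rE /=.
  by have /asboolP[x <-] := y_im.
exists (submodule (im q)), (val : {linear submodule (im q) -> P}), r.
split=> // M N g f g_surj.
have [h hE] := projP _ _ g (f \o r) g_surj.
by exists (h \o (val : {linear submodule (im q) -> P})) => x /=;
  have /= -> := hE (val x); rewrite jK.
Qed.

(** The comparison map [P -> A -> P] over [M] is invertible by the covering
    property, so correcting by its inverse turns [A -> P] into an exact
    retraction. *)
Lemma projective_cover_split (R : pzRingType) (P M A : lmodType R)
    (p : {linear P -> M}) (pA : {linear A -> M}) :
    projective_cover p -> projective A -> surjective pA ->
  exists (a : {linear P -> A}) (b : {linear A -> P}),
    [/\ cancel a b, forall x, pA (a x) = p x & forall y, p (b y) = pA y].
Proof.
move=> [projP p_surj p_cover] projA pA_surj.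
have [a aE] := projP _ _ pA p pA_surj.
have [b bE] := projA _ _ p pA p_surj.
have pba : p \o (b \o a) =1 p.
  by move=> x /=; have /= -> := bE (a x); have /= -> := aE x.
have [v [vK Kv]] := linear_inverse (p_cover _ pba).
exists a, (v \o b); split=> [x|x|y] /=; first exact: vK.
  exact: aE.
rewrite -[RHS]bE /= -[b y in RHS]Kv.
by have /= -> := pba (v (b y)).
Qed.

Lemma coker_presentation (R : pzRingType) (P1 P0 S : lmodType R)
    (sigma : {linear P1 -> P0}) :
    isomorphic S (coker sigma) ->
  exists p0 : {linear P0 -> S},
    surjective p0 /\ (forall y, p0 y = 0 <-> exists x, sigma x = y).
Proof.
move=> [f /linear_inverse [g [fK gK]]].
exists (g \o quotpi (im sigma)); split=> [s|y] /=.
  by have [y yE] := quotpi_surjective (f s); exists y; rewrite yE fK.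
have -> : (g (quotpi (im sigma) y) = 0) <-> (quotpi (im sigma) y = 0).
  by split=> [/(congr1 f)|->]; rewrite ?gK !linear0.
by rewrite (rwP eqP) quotpi_eq0; split=> [/asboolP|?] //; exact/asboolP.
Qed.

(** If [P] is a retract of [P0] over [S], then the complement [ker b] of [a P]
    lies in the image of [sigma], and lifting the projection onto it along
    [sigma] gives the complementary idempotent of [q]: what is left maps onto
    [a (ker p)]. *)
Lemma presentation_reduction (R : pzRingType) (P P1 P0 S : lmodType R)
    (sigma : {linear P1 -> P0}) (p0 : {linear P0 -> S}) (p : {linear P -> S})
    (a : {linear P -> P0}) (b : {linear P0 -> P}) :
    projective P0 -> (forall y, p0 y = 0 <-> exists x, sigma x = y) ->
    cancel a b -> (forall x, p0 (a x) = p x) -> (forall y, p (b y) = p0 y) ->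
  exists q : {linear P1 -> P1},
    [/\ forall x, q (q x) = q x,
        forall x, exists2 y, p y = 0 & sigma (q x) = a y
      & forall y, p y = 0 -> exists x, sigma (q x) = a y].
Proof.
move=> projP0 ker_p0 aK p0a pb.
have abab x : a (b (a (b x))) = a (b x) by rewrite aK.
have [e0 [e0E e0e0]] := @sub_idem _ _ (a \o b) abab.
have e0_im x : exists y, sigma y = e0 x.
  by apply/ker_p0; rewrite e0E linearB /= p0a pb subrr.
have [s sE] := projective_lift_im projP0 e0_im.
(* Precomposing the lift with [e0] makes the endomorphism idempotent. *)
have tt x : s (e0 (sigma (s (e0 (sigma x))))) = s (e0 (sigma x)).
  by rewrite sE !e0e0.
have [q [qE qq]] := @sub_idem _ _ (s \o (e0 \o sigma)) tt.
have sigma_q x : sigma (q x) = a (b (sigma x)).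
  by rewrite qE linearB /= sE e0e0 e0E /= opprB addrC subrK.
exists q; split=> // [x|y py0].
  exists (b (sigma x)); last exact: sigma_q.
  by rewrite pb; apply/ker_p0; exists x.
have [x xE] : exists x, sigma x = a y by apply/ker_p0; rewrite p0a.
by exists x; rewrite sigma_q xE aK.
Qed.

Lemma Gen_refl (R : pzRingType) (S : lmodType R) : Gen S S.
Proof.
have ev_lin : linear (fun u : dsum unit S => val u tt) by [].
pose ev : {linear dsum unit S -> S} :=
  HB.pack (fun u : dsum unit S => val u tt)
    (GRing.isLinear.Build R (dsum unit S) S _ _ ev_lin).
exists unit, ev => x.
have x_fin : (fun _ : unit => x) \in @finite_support unit R S.
  by apply/asboolP; exact: finite_finset.
by exists (exist _ (fun _ => x) x_fin : dsum unit S).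
Qed.

(** * Traces and quotients by two-sided ideals *)

(** Describing the trace of a summand [Q] of [P] by maps on [P] precomposed with
    the idempotent avoids mentioning maps on [Q].  Two maps
    suffice below, one for each part of [i = i e + i (1 - e)]. *)
Lemma trace_retractP (R : pzRingType) (P Q : lmodType R)
    (j : {linear Q -> P}) (r : {linear P -> Q}) (N : submodClosed R^o) :
    cancel j r ->
    (forall (f : {linear P -> R^o}) x, f (j (r x)) \in N) ->
    (forall i, i \in N -> exists (f g : {linear P -> R^o}) x y,
        i = f (j (r x)) + g (j (r y))) ->
  trace Q = [set` N].
Proof.
move=> jK fN Nf; apply/seteqP; split=> [z [s [sQ ->]]|i /= iN].
  rewrite /= big_seq; apply: rpred_sum => y /sQ[f _ [x _ <-]].
  by have /= := fN (f \o r) (j x); rewrite !jK.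
have [f [g [x [y iE]]]] := Nf i iN.
exists [:: f (j (r x)); g (j (r y))]; split; last by rewrite big_cons big_seq1.
move=> z; rewrite !inE => /orP[] /eqP ->.
  by exists (f \o j) => //; exists (r x).
by exists (g \o j) => //; exists (r y).
Qed.

Lemma quotmod_annihilated (R : pzRingType) (I : twoSidedIdeal R) (i : R)
    (x : quotmod I) : i \in I -> i *: x = 0.
Proof.
move=> iI; have [r <-] := @quotpi_surjective _ _ I x.
by rewrite -linearZ; apply/eqP; rewrite quotpi_eq0; exact: rmul_closed.
Qed.

(** As [P] is a summand of [R] over [R/I], an element of [ker p] is a multiple
    of a fixed element by a scalar in [I]. *)
Lemma cover_kernel_vanish (R : pzRingType) (I : twoSidedIdeal R)
    (P : lmodType R) (p : {linear P -> quotmod I})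
    (c : {linear P -> R^o}) (d : {linear R^o -> P})
    (h : {linear P -> quotmod I}) (y : P) :
    cancel c d -> (forall x, quotpi I (c x) = p x) -> p y = 0 -> h y = 0.
Proof.
move=> cK pic py0; have cyI : c y \in I by rewrite -quotpi_eq0 pic py0 eqxx.
have -> : y = (c y : R) *: d 1.
  by rewrite -linearZ -[LHS]cK; congr (d _); exact/esym/mulr1.
by rewrite linearZ; exact: quotmod_annihilated.
Qed.

Lemma complement_in_ideal (R : pzRingType) (I : twoSidedIdeal R)
    (P : lmodType R) (p : {linear P -> quotmod I})
    (c : {linear P -> R^o}) (d : {linear R^o -> P})
    (f : {linear R^o -> R^o}) (r : R^o) :
    (forall x, quotpi I (c x) = p x) -> (forall s, p (d s) = quotpi I s) ->
  f (r - c (d r)) \in I.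
Proof.
move=> pic pd; set z := r - _.
have zI : z \in I by rewrite -quotpi_eq0 linearB /= pic pd subrr.
have -> : f z = (z : R) * f 1.
  by rewrite -[RHS]linearZ /=; congr (f _); exact/esym/mulr1.
exact: rmul_closed.
Qed.

Theorem theoremB (R : pzRingType) (I : twoSidedIdeal R)
    (hidem : @ideal_mul R I I = [set` I] :> set R)
    (hcover : exists (P : lmodType R) (p : {linear P -> quotmod I}),
        projective_cover p)
    (hsilt : silting (quotmod I)) :
  exists P : lmodType R, projective P /\ trace P = [set` I] :> set R.
Proof.
have [P [p p_cover]] := hcover.
have [P1 [P0 [sigma [projP1 projP0 isoS DGen]]]] := hsilt.
have [p0 [p0_surj ker_p0]] := coker_presentation isoS.
have [a [b [aK p0a pb]]] := projective_cover_split p_cover projP0 p0_surj.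
have [c [d [cK pic pd]]] := projective_cover_split p_cover
  (@projective_regular R) (@quotpi_surjective _ _ I).
have [q [qq q_ker ker_q]] :=
  presentation_reduction projP0 ker_p0 aK p0a pb.
have cdcd r : c (d (c (d r))) = c (d r) by rewrite cK.
(* [c \o d] is right multiplication by [e], and [e'] by [1 - e]. *)
have [e' [e'E e'e']] := @sub_idem _ _ (c \o d) cdcd.
pose T : lmodType R := (P1 * R^o)%type.
have eps_lin : linear (fun x : T => (q x.1, e' x.2) : T).
  by move=> k x y /=; rewrite !linearP.
pose eps : {linear T -> T} := HB.pack (fun x : T => (q x.1, e' x.2) : T)
  (GRing.isLinear.Build R T T _ _ eps_lin).
have epseps x : eps (eps x) = eps x by rewrite /= qq e'e'.
have projT : projective T by exact: projective_prod projP1 (@projective_regular R).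
have [Q [j [r [projQ jK jr]]]] := @idempotent_split _ _ eps projT epseps.
exists Q; split=> //.
apply: (trace_retractP jK) => [f x|i iI]; last first.
  pose y := d i.
  have py0 : p y = 0 by rewrite pd; apply/eqP; rewrite quotpi_eq0.
  have [x xE] := ker_q y py0.
  (* [c (d i)] is [i e], obtained as [c (b (sigma x))]. *)
  exists (c \o (b \o (sigma \o fst))), snd, (x, 0), (0, i).
  by rewrite !jr /= xE aK e'E /= addrC subrK.
rewrite jr /= pair_split linearD rpredD //; last first.
  by rewrite e'E; exact: (complement_in_ideal (f \o @prod_inr _ P1 R^o) x.2 pic pd).
(* [R/I] lies in [Dclass sigma], so the map induced on [P1] extends to [P0]. *)
have [h hE] := (DGen (quotmod I)).2 (Gen_refl _)
  (quotpi I \o (f \o @prod_inl _ P1 R^o)).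
have [y py0 yE] := q_ker x.1.
rewrite -quotpi_eq0; have /= <- := hE (q x.1); rewrite yE.
exact/eqP/(cover_kernel_vanish (h \o a) cK pic py0).
Qed.
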